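(* Let $\mathfrak a=\mathbb C\oplus\mathcal D$ be a thermal Itô B*-algebra. Then there are a Wiener B*-algebra $\mathfrak b=\mathbb C\oplus\mathcal G\subseteq\mathfrak a$ and a Poisson B*-algebra $\mathfrak c=\mathbb C\oplus\mathcal E\subseteq\mathfrak a$ such that $\mathfrak a$ is their orthogonal sum: $$\mathfrak a=\mathfrak b+\mathfrak c,\qquad \mathfrak b\mathfrak c=\{0\},$$ that is, $bc=0$ for all $b\in\mathfrak b$, $c\in\mathfrak c$.
   Context: **The algebra $\mathcal D$.** Let $\mathcal D$ be a complex associative algebra with a conjugate-linear involution $\xi\mapsto\xi^\star$, $\xi^{\star\star}=\xi$, $(\xi\zeta)^\star=\zeta^\star\xi^\star$, equipped with a (positive definite) inner product $\langle\cdot|\cdot\rangle_+$, conjugate-linear in the first and linear in the second argument, with norm $\|\cdot\|_+$. Define the right inner product by $\langle\eta|\zeta\rangle^-=\langle\eta^\star|\zeta^\star\rangle_+$ (linear in the first argument), with norm $\|\xi\|^-=\|\xi^\star\|_+$. These two norms are called the Hilbert norms. The algebra $\mathcal D$ is a left Tomita $\star$-algebra (hence a right one), meaning that: - for all $\xi,\zeta,\eta\in\mathcal D$: $\langle\eta\zeta^\star|\xi\rangle^-=\langle\eta|\xi\zeta\rangle^-$ and $\langle\eta^\star\zeta|\xi\rangle_+=\langle\zeta|\eta\xi\rangle_+$; - there is a subspace $\mathcal D_+\subseteq\mathcal D$, dense with respect to $\|\cdot\|_+$, with an involution $\zeta\mapsto\zeta^\flat$ of $\mathcal D_+$ onto itself,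 $\zeta^{\flat\flat}=\zeta$, such that $\langle\zeta|\xi^\star\rangle_+=\langle\xi|\zeta^\flat\rangle_+$ for all $\zeta\in\mathcal D_+$, $\xi\in\mathcal D$; correspondingly, on $\mathcal D^-=\{\zeta^\star:\zeta\in\mathcal D_+\}$ the involution $\eta^\sharp=((\eta^\star)^\flat)^\star$ satisfies $\langle\eta|\xi^\star\rangle^-=\langle\xi|\eta^\sharp\rangle^-$ for all $\eta\in\mathcal D^-$, $\xi\in\mathcal D$; - left multiplications are continuous for $\|\cdot\|_+$ and right multiplications are continuous for $\|\cdot\|^-$: $$\|\xi\|:=\sup\{\|\xi\zeta\|_+:\|\zeta\|_+\le1\}=\sup\{\|\eta\xi\|^-:\|\eta\|^-\le1\}<\infty\quad\text{for each }\xi\in\mathcal D.$$ It is not required that the span $\mathcal D\mathcal D$ of products be dense in $\mathcal D$ for the Hilbert norms. **Thermal Itô B*-algebra.** It is the space $\mathfrak a=\mathbb C\oplus\mathcal D$ of pairs $a=(\alpha,\xi)$, for such a $\mathcal D$ which is complete jointly with respect to $\|\cdot\|$, $\|\cdot\|^-$, $\|\cdot\|_+$ (i.e. complete for the sum of the three), with involution $(\alpha,\xi)^\star=(\bar\alpha,\xi^\star)$ and product $$(\alpha,\xi)(\beta,\zeta)=(\langle\xi^\star|\zeta\rangle_+,\ \xi\zeta),$$ so that $a^\star a=(\langle\xi|\xi\rangle_+,\xi^\star\xi)$ and $aa^\star=(\langle\xi|\xi\rangle^-,\xi\xi^\star)$. Its death is $\theta=(1,0)$ and its functional is $l(\alpha,\xi)=\alpha$.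 **Wiener and Poisson B*-algebras in $\mathfrak a$.** A Wiener B*-algebra $\mathfrak b\subseteq\mathfrak a$ is $\mathfrak b=\mathbb C\oplus\mathcal G$, where $\mathcal G\subseteq\mathcal D$ is a $\star$-invariant subspace with trivial product ($\eta\zeta=0$ in $\mathcal D$ for all $\eta,\zeta\in\mathcal G$) which is closed with respect to the norm of the summed inner product of $\langle\cdot|\cdot\rangle^-$ and $\langle\cdot|\cdot\rangle_+$, i.e. the norm $((\|\xi\|^-)^2+\|\xi\|_+^2)^{1/2}$. A Poisson B*-algebra $\mathfrak c\subseteq\mathfrak a$ is $\mathfrak c=\mathbb C\oplus\mathcal E$, where $\mathcal E\subseteq\mathcal D$ is a $\star$-subalgebra closed in $\mathcal D$ (jointly in the three norms) and non-degenerate on itself: the linear span $\mathcal E\mathcal E$ of products is dense in $\mathcal E$ with respect to the Hilbert norms. *)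

(* Defs.v *)
From HB Require Import structures.
From mathcomp Require Import all_boot all_order all_algebra.
From mathcomp Require Import complex.
From mathcomp Require Import all_classical all_reals all_analysis.

Set Implicit Arguments.
Unset Strict Implicit.
Unset Printing Implicit Defensive.

Import Order.TTheory GRing.Theory Num.Theory.
Import numFieldNormedType.Exports.

Local Open Scope classical_set_scope.
Local Open Scope ring_scope.

(* A complex associative algebra, without unit, with a conjugate-linear
   involution and an inner product.  MathComp's [{dot V for conjC}] is linear
   in its first and conjugate-linear in its second argument, so that
   <xi|zeta>_+ is [adot zeta xi]; see [lip]. *)
Record star_ip_algebra (R : realType) := StarIpAlgebra {
  carrier :> lmodType R[i];
  amul : {bilinear carrier -> carrier -> carrier};
  astar : carrier -> carrier;
  adot : {dot carrier for @Num.conj R[i]};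
  amulA : associative amul;
  astar_semilinear : forall (c : R[i]) (x y : carrier),
    astar (c *: x + y) = c^* *: astar x + astar y;
  astarK : involutive astar;
  astarM : forall x y : carrier, astar (amul x y) = amul (astar y) (astar x)
}.

Section Norms.
Context {R : realType} {D : star_ip_algebra R}.
Implicit Types (x y : D) (A B : set D) (N : D -> R).

(* <x|y>_+ and <x|y>^- *)
Definition lip x y : R[i] := adot D y x.
Definition rip x y : R[i] := lip (astar x) (astar y).

Definition lnorm x : R := Num.sqrt (complex.Re (lip x x)).
Definition rnorm x : R := Num.sqrt (complex.Re (rip x x)).

Definition lopnorm x : \bar R :=
  ereal_sup [set (lnorm (amul D x z))%:E | z in [set z | lnorm z <= 1]].
Definition ropnorm x : \bar R :=
  ereal_sup [set (rnorm (amul D z x))%:E | z in [set z | rnorm z <= 1]].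

Definition hilbert_norm x : R := Num.sqrt (rnorm x ^+ 2 + lnorm x ^+ 2).

(* [fine] is harmless here: [lopnorm] is finite in a Tomita algebra. *)
Definition joint_norm x : R := fine (lopnorm x) + rnorm x + lnorm x.

Definition closure_for N A : set D :=
  [set x | forall e : R, 0 < e -> exists2 y, A y & N (x - y) < e].
Definition closed_for N A := closure_for N A `<=` A.
Definition dense_for N A B := B `<=` closure_for N A.

Definition cauchy_for N (u : nat -> D) :=
  forall e : R, 0 < e ->
    exists n0, forall m n, (n0 <= m)%N -> (n0 <= n)%N -> N (u m - u n) < e.
Definition complete_for N :=
  forall u : nat -> D, cauchy_for N u ->
    exists l, N (u n - l) @[n --> \oo] --> (0 : R).

Definition linear_subspace A := GRing.submod_closed (mem A).
Definition linear_span A : set D := smallest linear_subspace A.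
Definition products A : set D := [set amul D x y | x in A & y in A].
Definition star_invariant A := forall x, A x -> A (astar x).

End Norms.

Arguments complete_for {R} D N.

(* The involution on [astar @` Dp] corresponding to [flat] is not listed: its
   adjunction property follows from [flat_adj], see [sharp_adj] below. *)
Record tomita_involution (R : realType) (D : star_ip_algebra R)
    (Dp : set D) (flat : D -> D) : Prop := {
  flat_dom : linear_subspace Dp;
  flat_dense : dense_for lnorm Dp [set: D];
  flat_in : forall z, Dp z -> Dp (flat z);
  flatK : forall z, Dp z -> flat (flat z) = z;
  flat_adj : forall z x : D, Dp z -> lip z (astar x) = lip x (flat z)
}.

Record tomita (R : realType) (D : star_ip_algebra R) : Prop := {
  tomita_rip : forall x z y : D,
    rip (amul D y (astar z)) x = rip y (amul D x z);
  tomita_lip : forall x z y : D,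
    lip (amul D (astar y) z) x = lip z (amul D y x);
  tomita_flat : exists (Dp : set D) (flat : D -> D), tomita_involution Dp flat;
  tomita_opnorm : forall x : D, lopnorm x = ropnorm x;
  tomita_bounded : forall x : D, (lopnorm x < +oo)%E
}.

Lemma sharp_adj (R : realType) (D : star_ip_algebra R) (Dp : set D)
    (flat : D -> D) (hflat : tomita_involution Dp flat) (y x : D) :
  (@astar R D @` Dp) y -> rip y (astar x) = rip x (astar (flat (astar y))).
Proof.
case=> z Dpz <-; rewrite /rip !astarK.
by rewrite -(flat_adj hflat) ?astarK.
Qed.

Definition thermal (R : realType) (D : star_ip_algebra R) : Prop :=
  tomita D /\ complete_for D joint_norm.

Section Ito.
Context {R : realType} {D : star_ip_algebra R}.

Definition ito : zmodType := (R[i] * D)%type.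

Definition ito_star (a : ito) : ito := (a.1^*, astar a.2).
Definition ito_mul (a b : ito) : ito := (lip (astar a.2) b.2, amul D a.2 b.2).
Definition ito_death : ito := (1, 0).
Definition ito_functional (a : ito) : R[i] := a.1.

(* C (+) G as a subset of C (+) D *)
Definition ito_sub (G : set D) : set ito := [set a | G a.2].

Definition wiener (b : set ito) : Prop :=
  exists2 G : set D, b = ito_sub G &
    [/\ linear_subspace G, star_invariant G,
        forall x y, G x -> G y -> amul D x y = 0 &
        closed_for hilbert_norm G].

Definition poisson (c : set ito) : Prop :=
  exists2 E : set D, c = ito_sub E &
    [/\ linear_subspace E, star_invariant E, products E `<=` E,
        closed_for joint_norm E &
        dense_for hilbert_norm (linear_span (products E)) E].

End Ito.

Arguments ito {R} D.

Lemma ito_starM (R : realType) (D : star_ip_algebra R) (a : ito D) :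
  ito_mul (ito_star a) a = (lip a.2 a.2, amul D (astar a.2) a.2) /\
  ito_mul a (ito_star a) = (rip a.2 a.2, amul D a.2 (astar a.2)).
Proof. by rewrite /ito_mul /ito_star /= astarK. Qed.

(* Main.v *)
(** The Wiener part is the annihilator [G] of [D] and the Poisson part is the
    joint closure [E] of the span of products.  The point is that [D = G + E].
    Let [x] have operator norm at most 1, let [k = x x^*] act on [D] by left
    multiplication, and put [z_n = (1 - k)^n x], so that [x - z_n] is in the
    span of products.  Since [0 <= k <= 1], the moments
    [a_j = <v|(1 - k)^j v>_+] are nonnegative and decrease in [j], which makes
    [(1 - k)^n v] Cauchy; the same applies to [z_n^* = (1 - x^* x)^n x^*], and
    [||z_n|| -> 0] because [t (1 - t)^(2n)] is [O(1/n)] on [[0, 1]].  So [z_n] is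
    jointly Cauchy, its limit has operator norm 0 and hence lies in [G], and
    [x] minus this limit lies in [E]. *)

Require Import Defs.
From mathcomp Require Import all_boot all_order all_algebra.
From mathcomp Require Import complex.
From mathcomp Require Import all_classical all_reals all_analysis.
From mathcomp Require Import lra ring.

Set Implicit Arguments.
Unset Strict Implicit.
Unset Printing Implicit Defensive.

Import Order.TTheory GRing.Theory Num.Theory.
Import numFieldNormedType.Exports.

Local Open Scope classical_set_scope.
Local Open Scope ring_scope.

(** * The real inner product and Cauchy-Schwarz *)

Section InnerProduct.
Context {R : realType} {D : star_ip_algebra R}.
Implicit Types (x y z : D).

(** The real part is a real inner product with the same norm, so estimates stay in [R];
    [annihilator_orthogonal] recovers the imaginary part. *)
Definition rdot x y : R := complex.Re (lip x y).

Lemma lnormE x : lnorm x = Num.sqrt (rdot x x). Proof. by []. Qed.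

Lemma lip_conjC x y : lip x y = (lip y x)^*.
Proof. by rewrite /lip hermC expr0 mul1r. Qed.

Lemma rdotC x y : rdot x y = rdot y x.
Proof. by rewrite /rdot lip_conjC; case: (lip y x). Qed.

Lemma rdotDr x y z : rdot x (y + z) = rdot x y + rdot x z.
Proof. by rewrite /rdot /lip linearDl raddfD. Qed.

Lemma rdotDl x y z : rdot (x + y) z = rdot x z + rdot y z.
Proof. by rewrite rdotC rdotDr !(rdotC z). Qed.

Lemma rdot0r x : rdot x 0 = 0.
Proof. by rewrite /rdot /lip linear0l. Qed.

Lemma rdotNr x y : rdot x (- y) = - rdot x y.
Proof. by rewrite /rdot /lip linearNl raddfN. Qed.

Lemma rdotNl x y : rdot (- x) y = - rdot x y.
Proof. by rewrite rdotC rdotNr rdotC. Qed.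

Definition rdotE := (rdotDl, rdotDr, rdotNl, rdotNr).

Lemma rdotZr (t : R) x y : rdot x (t%:C%C *: y) = t * rdot x y.
Proof.
rewrite /rdot /lip linearZl_LR /=; case: (adot D y x) => a b /=.
by rewrite mul0r subr0.
Qed.

Lemma rdotZl (t : R) x y : rdot (t%:C%C *: x) y = t * rdot x y.
Proof. by rewrite rdotC rdotZr rdotC. Qed.

Lemma lip_ge0 x : 0 <= lip x x. Proof. exact: dnorm_ge0. Qed.

Lemma rdotxx_ge0 x : 0 <= rdot x x.
Proof. by have := lip_ge0 x; rewrite /rdot lecE => /andP[]. Qed.

Lemma lipxxE x : lip x x = (rdot x x)%:C%C.
Proof.
have := lip_ge0 x; rewrite lecE /rdot => /andP[/eqP h _].
by case: (lip x x) h => a b /= ->.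
Qed.

Lemma rdotxx_eq0 x : rdot x x = 0 -> x = 0.
Proof.
by move=> h; apply/eqP; rewrite -(dnorm_eq0 (adot D)) -/(lip x x) lipxxE h.
Qed.

Lemma lnorm_ge0 x : 0 <= lnorm x. Proof. exact: sqrtr_ge0. Qed.

Lemma lnorm_sqr x : lnorm x ^+ 2 = rdot x x.
Proof. by rewrite sqr_sqrtr ?rdotxx_ge0. Qed.

Lemma lnorm_eq0 x : lnorm x = 0 -> x = 0.
Proof. by move=> h; apply: rdotxx_eq0; rewrite -lnorm_sqr h expr0n. Qed.

Lemma lnorm0 : lnorm (0 : D) = 0.
Proof. by rewrite /lnorm /lip linear0l sqrtr0. Qed.

Lemma lnormZ (c : R[i]) x : lnorm (c *: x) = Normc.normc c * lnorm x.
Proof.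
rewrite !lnormE /rdot /lip dnormZ -/(lip x x) lipxxE normc_def.
rewrite -rmorphXn -rmorphM /= sqrtrM ?sqr_ge0 // sqrtr_sqr ger0_norm ?sqrtr_ge0//.
by case: c.
Qed.

(** Expand [0 <= || ||y|| x - ||x|| y ||^2] and divide by [2 ||x|| ||y||]. *)
Lemma rdot_le x y : rdot x y <= lnorm x * lnorm y.
Proof.
have [->|x0] := eqVneq x 0; first by rewrite rdotC rdot0r lnorm0 mul0r.
have {}x0 : 0 < lnorm x.
  by rewrite lt_neqAle lnorm_ge0 andbT eq_sym; apply: contraNneq x0 => /lnorm_eq0 ->.
have := rdotxx_ge0 ((lnorm y)%:C%C *: x - (lnorm x)%:C%C *: y).
rewrite !rdotE !rdotZl !rdotZr -!lnorm_sqr (rdotC y x) => h.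
have [->|y0] := eqVneq y 0; first by rewrite rdot0r lnorm0 mulr0.
have {}y0 : 0 < lnorm y.
  by rewrite lt_neqAle lnorm_ge0 andbT eq_sym; apply: contraNneq y0 => /lnorm_eq0 ->.
have xy0 := mulr_gt0 x0 y0.
rewrite -(ler_pM2l xy0); nra.
Qed.

Lemma lnormD x y : lnorm (x + y) <= lnorm x + lnorm y.
Proof.
rewrite -(ler_pXn2r (n:=2)) ?nnegrE ?addr_ge0 ?lnorm_ge0 //.
rewrite lnorm_sqr !rdotE (rdotC y x) sqrrD !lnorm_sqr.
have := rdot_le x y; lra.
Qed.

End InnerProduct.

Lemma le_of_sqr {R : realType} (a b : R) : 0 <= b -> a ^+ 2 <= b ^+ 2 -> a <= b.
Proof.
move=> b0 ab; apply: le_trans (ler_norm a) _.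
by rewrite -(ler_pXn2r (n:=2)) ?nnegrE // real_normK ?num_real.
Qed.

(** * Operator norm and adjoints *)

Section OperatorNorm.
Context {R : realType} {D : star_ip_algebra R} (hT : tomita D).
Implicit Types (x y z u v w : D) (c : R).
Local Notation "x ** y" := (amul D x y) (at level 40, left associativity).
Local Notation opnorm x := (fine (lopnorm x)).

Lemma astarD x y : astar (x + y) = astar x + astar y.
Proof. by rewrite -[x in LHS]scale1r astar_semilinear conjC1 scale1r. Qed.

Lemma astar0 : astar (0 : D) = 0.
Proof. by apply: (addIr (astar 0)); rewrite -astarD !add0r. Qed.

Lemma astarZ (c : R[i]) x : astar (c *: x) = c^* *: astar x.
Proof. by rewrite -[c *: x]addr0 astar_semilinear astar0 addr0. Qed.

Lemma astarN x : astar (- x) = - astar x.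
Proof. by apply: (addrI (astar x)); rewrite -astarD !subrr astar0. Qed.

Lemma rdot_adj x y z : rdot (astar y ** z) x = rdot z (y ** x).
Proof. by rewrite /rdot tomita_lip. Qed.

Lemma rdot_adj' x y z : rdot (y ** z) x = rdot z (astar y ** x).
Proof. by rewrite -rdot_adj astarK. Qed.

Lemma lopnorm_ge x z : lnorm z <= 1 -> lnorm (x ** z) <= opnorm x.
Proof.
move=> z1; have h : ((lnorm (x ** z))%:E <= lopnorm x)%E.
  by apply: ereal_sup_ubound; exists z.
rewrite -lee_fin fineK // fin_numE; apply/andP; split.
  (* The supremum dominates a real number, so it is not [-oo]. *)
  by apply: contraTneq h => ->.
by have := tomita_bounded hT x; rewrite lt_neqAle => /andP[].
Qed.

Lemma opnorm_ge0 x : 0 <= opnorm x.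
Proof. by apply: le_trans (lnorm_ge0 _) (@lopnorm_ge x 0 _); rewrite lnorm0. Qed.

Lemma normc_real c : 0 <= c -> Normc.normc c%:C%C = c.
Proof. by move=> c0 /=; rewrite expr0n addr0 sqrtr_sqr ger0_norm. Qed.

Lemma lnormM x z : lnorm (x ** z) <= opnorm x * lnorm z.
Proof.
have [z0|z0] := eqVneq (lnorm z) 0.
  by rewrite (lnorm_eq0 z0) linear0r !lnorm0 mulr0.
have zp : 0 < lnorm z by rewrite lt_neqAle eq_sym z0 lnorm_ge0.
have := @lopnorm_ge x ((lnorm z)^-1%:C%C *: z).
rewrite linearZr_LR !lnormZ !normc_real ?invr_ge0 ?lnorm_ge0 // mulVf // => /(_ (lexx _)).
by rewrite mulrC ler_pdivrMr.
Qed.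

Lemma opnorm_le x c : 0 <= c ->
  (forall z, lnorm (x ** z) <= c * lnorm z) -> opnorm x <= c.
Proof.
move=> c0 h; have : (lopnorm x <= c%:E)%E.
  apply: ge_ereal_sup => _ [z /= z1 <-]; rewrite lee_fin.
  by apply: le_trans (h z) _; rewrite ler_piMr.
have := opnorm_ge0 x; case: (lopnorm x) => //= r; by rewrite ?lee_fin.
Qed.

Lemma opnormD x y : opnorm (x + y) <= opnorm x + opnorm y.
Proof.
apply: opnorm_le => [|z]; first by rewrite addr_ge0 ?opnorm_ge0.
by rewrite linearDl mulrDl (le_trans (lnormD _ _)) // lerD ?lnormM.
Qed.

Lemma opnormZ (c : R[i]) x : opnorm (c *: x) <= Normc.normc c * opnorm x.
Proof.
have c0 : 0 <= Normc.normc c by case: c => a b /=; exact: sqrtr_ge0.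
apply: opnorm_le => [|z]; first by rewrite mulr_ge0 ?opnorm_ge0.
by rewrite linearZl_LR lnormZ -mulrA ler_wpM2l ?lnormM.
Qed.

(** [||x^* z||^2 = <z|x x^* z> <= ||z|| ||x|| ||x^* z||], and one factor [||x^* z||] cancels. *)
Lemma opnorm_star_le x : opnorm (astar x) <= opnorm x.
Proof.
apply: opnorm_le => [|z]; first exact: opnorm_ge0.
have [->|s0] := eqVneq (lnorm (astar x ** z)) 0.
  by rewrite mulr_ge0 ?opnorm_ge0 ?lnorm_ge0.
rewrite -(ler_pM2r (x := lnorm (astar x ** z))); last by rewrite lt_neqAle eq_sym s0 lnorm_ge0.
rewrite -expr2 lnorm_sqr rdot_adj (le_trans (rdot_le _ _)) //.
by rewrite mulrAC mulrC ler_wpM2r ?lnorm_ge0 ?lnormM.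
Qed.

Lemma opnorm_star x : opnorm (astar x) = opnorm x.
Proof.
apply/eqP; rewrite eq_le opnorm_star_le.
by rewrite -{1}(astarK x) opnorm_star_le.
Qed.

(** * Moments of the operator [1 - x x^*] *)

Section Damping.
Variable x : D.
Hypothesis x1 : opnorm x <= 1.

Definition damp x v := v - x ** (astar x ** v).
Local Notation T := (damp x).
Local Notation S := (damp (astar x)).

Lemma lnormM1 v : lnorm (x ** v) <= lnorm v.
Proof. by apply: le_trans (lnormM _ _) _; rewrite ler_piMl ?lnorm_ge0. Qed.

Lemma lnormsM1 v : lnorm (astar x ** v) <= lnorm v.
Proof.
by apply: le_trans (lnormM _ _) _; rewrite ler_piMl ?lnorm_ge0 // opnorm_star.
Qed.

Lemma rdot_damp u v : rdot (T u) v = rdot u (T v).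
Proof. by rewrite /damp !rdotE !rdot_adj' astarK. Qed.

Lemma rdot_iter_damp n u v : rdot (iter n T u) v = rdot u (iter n T v).
Proof. by elim: n u v => // n IHn u v; rewrite iterSr IHn iterS rdot_damp. Qed.

(** The moments of the spectral measure of [1 - x x^*] at [v]. Instead of locating that measure on
    [0, 1], the sign and the monotonicity are proved directly, by parity of [n]. *)
Definition moment v n := rdot v (iter n T v).

Lemma rdot_iter2 v m n : rdot (iter m T v) (iter n T v) = moment v (m + n).
Proof. by rewrite rdot_iter_damp /moment iterD. Qed.

(** With [u = T^m v], the moment is [||u||^2] for [n = 2m] and [||u||^2 - ||x^* u||^2] for
    [n = 2m + 1]. *)
Lemma moment_ge0 v n : 0 <= moment v n.
Proof.
rewrite -[n]odd_double_half -addnn; set m := n./2.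
case: (odd n); last by rewrite add0n -rdot_iter2 rdotxx_ge0.
rewrite add1n -addnS -rdot_iter2 iterS; set u := iter m T v.
rewrite /damp rdotE rdotNr rdotC rdot_adj' -!lnorm_sqr subr_ge0.
by rewrite ler_pXn2r ?nnegrE ?lnorm_ge0 ?lnormsM1.
Qed.

(** With [u = T^m v], the drop is [||x^* u||^2] for [n = 2m], and
    [<k u|T u> = ||x^* u||^2 - ||x x^* u||^2] for [n = 2m + 1]. *)
Lemma moment_decr v n : moment v n.+1 <= moment v n.
Proof.
rewrite -[n]odd_double_half -addnn; set m := n./2.
case: (odd n); rewrite ?add1n ?add0n.
  rewrite -addnS -addSn -!rdot_iter2 iterS.
  set u := iter m T v; rewrite {1}/damp rdotDl rdotNl.
  have -> : rdot (x ** (astar x ** u)) (T u) =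
    lnorm (astar x ** u) ^+ 2 - lnorm (x ** (astar x ** u)) ^+ 2.
    by rewrite /damp !rdotE !lnorm_sqr rdot_adj'.
  by rewrite gerDl oppr_le0 subr_ge0 ler_pXn2r ?nnegrE ?lnorm_ge0 ?lnormM1.
rewrite -addnS -!rdot_iter2 iterS; set u := iter m T v.
by rewrite /damp rdotDr rdotNr gerDl oppr_le0 rdotC rdot_adj' rdotxx_ge0.
Qed.

Lemma moment_cauchy v (e : R) : 0 < e -> exists n0, forall m n,
  (n0 <= m)%N -> (n0 <= n)%N -> `|moment v m - moment v n| < e.
Proof.
move=> e0; have e2 : 0 < e / 2 by lra.
have : cvgn (moment v).
  apply: nonincreasing_is_cvgn; first exact/nonincreasing_seqP/moment_decr.
  by exists 0 => _ [n _ <-]; exact: moment_ge0.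
move=> /cvg_ex [l] /cvgrPdist_lt /(_ _ e2)[n0 _ h].
exists n0 => m n /h /= hm /h /= hn.
rewrite (_ : _ - _ = - (l - moment v m) + (l - moment v n)); last by ring.
by rewrite (le_lt_trans (ler_normD _ _)) // normrN; lra.
Qed.

(* [||(1 - k)^m v - (1 - k)^n v||^2 = a_2m - 2 a_(m+n) + a_2n] *)
Lemma damp_cauchy v : cauchy_for lnorm (fun n => iter n T v).
Proof.
move=> e e0.
(* The squared distance is [(a_2m - a_(m+n)) + (a_2n - a_(m+n))], and each difference gets half of
   [e^2]. *)
have [n0 h] := @moment_cauchy v (e ^+ 2 / 2) ltac:(by rewrite divr_gt0 ?exprn_gt0).
exists n0 => m n hm hn.
rewrite ltNge; apply/negP => he.
have : e ^+ 2 <= lnorm (iter m T v - iter n T v) ^+ 2.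
  by rewrite ler_pXn2r ?nnegrE ?lnorm_ge0 // ltW.
rewrite lnorm_sqr !rdotE !rdot_iter2 (addnC n m).
have := h (m + m)%N (m + n)%N (leq_trans hm (leq_addr _ _)) (leq_trans hm (leq_addr _ _)).
have := h (n + n)%N (m + n)%N (leq_trans hn (leq_addr _ _)) (leq_trans hm (leq_addr _ _)).
by rewrite !ltr_norml => /andP[? ?] /andP[? ?] ?; lra.
Qed.

End Damping.

Lemma dampM x n w : iter n (damp x) (x ** w) = x ** iter n (damp (astar x)) w.
Proof.
by elim: n => //= n ->; rewrite /damp linearBr /= astarK.
Qed.

(** Left and right multiplications commute. This turns [||z_n w||^2] into a moment of [x w]. *)
Lemma iter_damp_mulr x n v w : iter n (damp x) v ** w = iter n (damp x) (v ** w).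
Proof. by elim: n => //= n <-; rewrite /damp linearBl /= -!amulA. Qed.

(* With [h = x^* x]: [h (1 - h)^j] is the difference of [(1 - h)^j] and
   [(1 - h)^(j+1)], so the moments of [x w] telescope into those of [w]. *)
Lemma moment_bound x n w : opnorm x <= 1 ->
  moment x (x ** w) n *+ n <= lnorm w ^+ 2 - moment (astar x) w n.
Proof.
move=> x1; elim: n => [|n IHn]; first by rewrite mulr0n /moment /= lnorm_sqr subrr.
have hd : moment x (x ** w) n = moment (astar x) w n - moment (astar x) w n.+1.
  rewrite /moment iterS dampM; set u := iter n _ w.
  by rewrite /damp astarK rdotDr rdotNr subKr rdot_adj'.
(* Monotonicity gives [(n+1) a_(n+1) <= a_n + n a_n]; by [hd] the first summand is the next
   telescoping term. *)
have := moment_decr x1 (x ** w) n; rewrite mulrS => h1.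
have : moment x (x ** w) n.+1 *+ n <= moment x (x ** w) n *+ n by rewrite lerMn2r h1 orbT.
lra.
Qed.

(** [||z_n w||^2] is the moment [a_2n] of [x w], and [2n a_2n <= ||w||^2]. Hence
    [a_2n <= e^2 n a_2n <= e^2 ||w||^2]. *)
Lemma opnorm_damp x n (e : R) : opnorm x <= 1 -> 0 < e -> 1 <= e ^+ 2 *+ n ->
  opnorm (iter n (damp x) x) <= e.
Proof.
move=> x1 e0 he; apply: opnorm_le => [|w]; first exact: ltW.
have s1 : opnorm (astar x) <= 1 by rewrite opnorm_star.
apply: le_of_sqr; first by rewrite mulr_ge0 ?lnorm_ge0 // ltW.
rewrite iter_damp_mulr lnorm_sqr rdot_iter2 exprMn.
set a := moment _ _ _.
have a0 : 0 <= a by exact: moment_ge0.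
have := moment_bound (n + n) w x1; rewrite -/a.
have := moment_ge0 s1 w (n + n).
rewrite -[a *+ _]mulr_natr -[_ *+ n]mulr_natr in he *; rewrite natrD => h1 h2.
have h3 : a * n%:R <= lnorm w ^+ 2 by have : 0 <= a * n%:R by [rewrite mulr_ge0]; lra.
have e2 : 0 <= e ^+ 2 by exact: sqr_ge0.
nra.
Qed.

(** Through this identity [damp_cauchy] for [x^*] controls the right Hilbert norm of [z_n]. *)
Lemma astar_damp x n : astar (iter n (damp x) x) = iter n (damp (astar x)) (astar x).
Proof.
pose w m := iter m (damp (astar x)) (astar x).
(* [w m] has the form [p(x^* x) x^*] with a polynomial [p], so [x x^*] on its right passes to
   [x^* x] on its left. *)
have comm m : w m ** x ** astar x = astar x ** (x ** w m).
  rewrite /w; elim: m => [|m] /=; first by rewrite -!amulA.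
  set u := iter _ _ _ => IH.
  rewrite /damp astarK !linearBl /= linearBr /= linearBr /=.
  by congr (_ - _); rewrite -[in RHS]IH ?amulA.
elim: n => //= n IHn; rewrite {1 3}/damp astarD astarN !astarM !astarK IHn -/(w n).
by rewrite comm.
Qed.

End OperatorNorm.

(** * The joint norm *)

Section JointNorm.
Context {R : realType} {D : star_ip_algebra R} (hT : tomita D).
Implicit Types (x y z g : D) (A B : set D).
Local Notation "x ** y" := (amul D x y) (at level 40, left associativity).
Local Notation opnorm x := (fine (lopnorm x)).

Lemma normc_ge0 (c : R[i]) : 0 <= Normc.normc c.
Proof. by case: c => a b; exact: sqrtr_ge0. Qed.

Lemma normc_conj (c : R[i]) : Normc.normc c^* = Normc.normc c.
Proof. by case: c => a b /=; rewrite sqrrN. Qed.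

Lemma normcN1 : Normc.normc (-1 : R[i]) = 1.
Proof. by rewrite /Normc.normc /= oppr0 sqrrN expr1n expr0n addr0 sqrtr1. Qed.

(** The right Hilbert norm is by conversion the left one of the adjoint, so left estimates
    suffice. *)
Lemma joint_normE x : joint_norm x = opnorm x + lnorm (astar x) + lnorm x.
Proof. by []. Qed.

Lemma lnorm_le_joint x : lnorm x <= joint_norm x.
Proof. by rewrite joint_normE; have := opnorm_ge0 hT x; have := lnorm_ge0 (astar x); lra. Qed.

Lemma opnorm_le_joint x : opnorm x <= joint_norm x.
Proof. by rewrite joint_normE; have := lnorm_ge0 x; have := lnorm_ge0 (astar x); lra. Qed.

Lemma lnorm_le_hilbert x : lnorm x <= hilbert_norm x.
Proof.
apply: le_of_sqr; first exact: sqrtr_ge0.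
by rewrite [leRHS]sqr_sqrtr ?addr_ge0 ?sqr_ge0 // lerDr sqr_ge0.
Qed.

Lemma hilbert_le_joint x : hilbert_norm x <= joint_norm x.
Proof.
have o0 := opnorm_ge0 hT x; have l0 := lnorm_ge0 x; have r0 := lnorm_ge0 (astar x).
apply: le_of_sqr; first by rewrite joint_normE; lra.
rewrite [leLHS]sqr_sqrtr ?addr_ge0 ?sqr_ge0 // joint_normE.
change (rnorm x) with (lnorm (astar x)); nra.
Qed.

Lemma joint_normD x y : joint_norm (x + y) <= joint_norm x + joint_norm y.
Proof.
rewrite !joint_normE astarD; have := opnormD hT x y; have := lnormD x y.
have := lnormD (astar x) (astar y); lra.
Qed.

Lemma joint_normZ (c : R[i]) x : joint_norm (c *: x) <= Normc.normc c * joint_norm x.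
Proof.
rewrite !joint_normE astarZ !lnormZ normc_conj; have := opnormZ hT c x; lra.
Qed.

Lemma joint_norm_star x : joint_norm (astar x) = joint_norm x.
Proof. by rewrite !joint_normE opnorm_star // astarK addrAC. Qed.

Lemma joint_norm0 : joint_norm (0 : D) = 0.
Proof.
apply/eqP; rewrite eq_le (le_trans (lnorm_ge0 _) (lnorm_le_joint _)) andbT.
by rewrite -[0 : D](scale0r 0) (le_trans (joint_normZ _ _)) // Normc.normc0 mul0r.
Qed.

Lemma joint_normB x y : joint_norm (x - y) = joint_norm (y - x).
Proof.
have le (u v : D) : joint_norm (u - v) <= joint_norm (v - u).
  have -> : u - v = (-1) *: (v - u) by rewrite scaleN1r opprB.
  apply: le_trans (joint_normZ _ _) _.
  by rewrite normcN1 mul1r.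
by apply/eqP; rewrite eq_le !le.
Qed.

(** * Subspaces, spans and joint closures *)

Lemma linear_subspaceP A : linear_subspace A <->
  A 0 /\ forall (c : R[i]) x y, A x -> A y -> A (c *: x + y).
Proof.
split=> [[A0 Ac]|[A0 Ac]]; split.
- by move: A0; rewrite inE.
- by move=> c x y /mem_set Ax /mem_set Ay; exact/set_mem/Ac.
- by rewrite inE.
- by move=> c x y; rewrite !inE; exact: Ac.
Qed.

Lemma linear_subspaceD A x y : linear_subspace A -> A x -> A y -> A (x + y).
Proof. by move=> /linear_subspaceP[_ h] Ax Ay; rewrite -[x]scale1r; exact: h. Qed.

Lemma linear_subspaceZ A (c : R[i]) x : linear_subspace A -> A x -> A (c *: x).
Proof. by move=> /linear_subspaceP[A0 h] Ax; rewrite -[_ *: _]addr0; exact: h. Qed.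

Lemma linear_span_subspace A : linear_subspace (linear_span A).
Proof.
apply/linear_subspaceP; split=> [|c x y Ax Ay] M [sM AM].
  by have /linear_subspaceP[] := sM.
by have /linear_subspaceP[_] := sM; apply; [exact: Ax|exact: Ay].
Qed.

Lemma linear_spanS A B : A `<=` B -> linear_span A `<=` linear_span B.
Proof.
by move=> AB; apply: smallest_sub; [exact: linear_span_subspace|
  exact: subset_trans AB (@sub_gen_smallest _ _ _)].
Qed.

Lemma sub_closure A : A `<=` closure_for joint_norm A.
Proof. by move=> x Ax e e0; exists x => //; rewrite subrr joint_norm0. Qed.

Lemma closure_closed A : closed_for joint_norm (closure_for joint_norm A).
Proof.
move=> x Ax e e0; have e2 : 0 < e / 2 by lra.
have [y Ay xy] := Ax _ e2; have [z Az yz] := Ay _ e2; exists z => //.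
rewrite -[x](subrK y) -addrA (le_lt_trans (joint_normD _ _)) //; lra.
Qed.

Lemma closure_star A : star_invariant A -> star_invariant (closure_for joint_norm A).
Proof.
move=> sA x Ax e /Ax[y Ay xy]; exists (astar y); first exact: sA.
by rewrite -astarN -astarD joint_norm_star.
Qed.

Lemma closure_subspace A :
  linear_subspace A -> linear_subspace (closure_for joint_norm A).
Proof.
move=> sA; have /linear_subspaceP[A0 Ac] := sA.
apply/linear_subspaceP; split=> [|c x y Ax Ay e e0]; first exact: sub_closure.
have c0 := normc_ge0 c.
(* The combined error is at most [(|c| + 1) d], which is below [e]. *)
pose d := e / (Normc.normc c + 2).
have d0 : 0 < d by rewrite divr_gt0 //; lra.
have [x' Ax' hx] := Ax _ d0; have [y' Ay' hy] := Ay _ d0.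
exists (c *: x' + y'); first exact: Ac.
rewrite opprD addrACA -scalerBr (le_lt_trans (joint_normD _ _)) //.
have := joint_normZ c (x - x').
have : d * (Normc.normc c + 2) = e by rewrite /d divfK //; apply: lt0r_neq0; lra.
nra.
Qed.

(** * The annihilator of [D] *)

Definition annihilator : set D := [set g | forall z, z ** g = 0].

Lemma annihilator_subspace : linear_subspace annihilator.
Proof.
apply/linear_subspaceP; split=> [z|c x y Ax Ay z]; first by rewrite linear0r.
by rewrite linearDr linearZr_LR Ax Ay scaler0 addr0.
Qed.

(* Left multiplication by [g] vanishes iff its adjoint, left multiplication by
   [g^*], does; hence the left and right annihilators coincide. *)
Lemma annihilatorP g : annihilator g <-> forall z, g ** z = 0.
Proof.
split=> [Ag z|Ag z].
  apply: rdotxx_eq0; rewrite (rdot_adj' hT) amulA Ag linear0l rdot0r //.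
rewrite -[z]astarK -[g]astarK -astarM; suff -> : astar g ** astar z = 0 by exact: astar0.
by apply: rdotxx_eq0; rewrite (rdot_adj hT) Ag rdot0r.
Qed.

Lemma annihilator_star : star_invariant annihilator.
Proof. by move=> g /annihilatorP Ag z; rewrite -[z]astarK -astarM Ag astar0. Qed.

(** Left multiplication by [z] is [lnorm]-continuous and [lnorm <= hilbert_norm], so its kernel is
    closed. *)
Lemma annihilator_closed : closed_for hilbert_norm annihilator.
Proof.
move=> g cg z; apply: lnorm_eq0; apply/eqP; rewrite eq_le lnorm_ge0 andbT.
apply/ler_addgt0Pr => e e0; rewrite add0r.
have o0 := opnorm_ge0 hT z.
have [a Aa] := cg (e / (opnorm z + 1)) ltac:(by rewrite divr_gt0 //; lra).
rewrite ltr_pdivlMr; last lra.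
move=> ha.
rewrite -[g](subrK a) linearDr Aa addr0 (le_trans (lnormM hT _ _)) //.
have := lnorm_le_hilbert (g - a); have := lnorm_ge0 (g - a); nra.
Qed.

(** * The closed span of products and its orthogonality to the annihilator *)

Definition product_span : set D := linear_span (products setT).
Definition product_core : set D := closure_for joint_norm product_span.

Lemma product_spanM x y : product_span (x ** y).
Proof. by apply: sub_gen_smallest; exists x => //; exists y. Qed.

Lemma product_span_star : star_invariant product_span.
Proof.
(* Span induction: the preimage of a complex subspace under a conjugate-linear map is again a
   complex subspace. *)
apply: (@smallest_sub _ linear_subspace _ [set x | product_span (astar x)]).
  have /linear_subspaceP[s0 sc] := @linear_span_subspace (products setT).
  apply/linear_subspaceP; split=> [|c x y /= Sx Sy]; rewrite /= ?astar0 //.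
  by rewrite astarD astarZ; exact: sc.
by move=> _ [x _ [y _ <-]] /=; rewrite astarM; exact: product_spanM.
Qed.

Lemma product_core_subspace : linear_subspace product_core.
Proof. exact/closure_subspace/linear_span_subspace. Qed.

(** On products, [<g^*|u v> = <u^* g^*|v> = 0] because [g^*] is annihilated too; Cauchy-Schwarz
    carries this to the closure. It kills the scalar component of the Itô product. *)
Lemma annihilator_orthogonal g x : annihilator g -> product_core x -> lip (astar g) x = 0.
Proof.
move=> Ag Ex.
have orth_span s : product_span s -> lip (astar g) s = 0.
  move=> Ss; apply: (@smallest_sub _ linear_subspace _ [set s | lip (astar g) s = 0] _ _ s Ss).
    apply/linear_subspaceP; split=> [|c u v /= hu hv]; first by rewrite /= /lip linear0l.
    by move: hu hv; rewrite /lip linearDl linearZl_LR /= => -> ->; rewrite mulr0 addr0.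
  move=> _ [u _ [v _ <-]] /=; have /annihilatorP Ags := annihilator_star Ag.
  rewrite lip_conjC -[u]astarK (tomita_lip hT) (annihilator_star Ag) /lip linear0l.
  exact: conjC0.
have rdot_le0 y : product_core y -> rdot (astar g) y <= 0.
  move=> Ey; apply/ler_addgt0Pr => e e0; rewrite add0r.
  have g0 := lnorm_ge0 (astar g).
  have [s Ss] := Ey (e / (lnorm (astar g) + 1)) ltac:(by rewrite divr_gt0 //; lra).
  rewrite ltr_pdivlMr; last lra.
  move=> hs; rewrite -[y](subrK s) rdotDr {2}/rdot (orth_span _ Ss) addr0.
  apply: le_trans (rdot_le _ _) _.
  have := lnorm_le_joint (y - s); have := lnorm_ge0 (y - s); nra.
have rdot_eq0 y : product_core y -> rdot (astar g) y = 0.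
  move=> Ey; apply/eqP; rewrite eq_le rdot_le0 //= -oppr_le0 -rdotNr rdot_le0 //.
  by rewrite -scaleN1r; exact: linear_subspaceZ product_core_subspace Ey.
(* The real part of [<g^*|i x>] is minus the imaginary part of [<g^*|x>]. *)
have := rdot_eq0 _ (linear_subspaceZ (Complex 0 1) product_core_subspace Ex).
have := rdot_eq0 _ Ex; rewrite /rdot /lip linearZl_LR /=.
case: (adot D x (astar g)) => a b /=; rewrite mul0r mul1r sub0r => -> /eqP.
by rewrite oppr_eq0 => /eqP ->.
Qed.

(** * The decomposition of [D] *)

Lemma damp_sub_product_span x n : product_span (x - iter n (damp x) x).
Proof.
elim: n => [|n IHn] /=.
  by rewrite subrr; have /linear_subspaceP[] := linear_span_subspace (products [set: D]).
(* [x - z_(n+1)] is [x - z_n] plus the single product [x (x^* z_n)]. *)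
rewrite /damp opprB addrCA addrC.
exact: linear_subspaceD (linear_span_subspace _) IHn (product_spanM _ _).
Qed.

Lemma opnorm_damp_small x (e : R) : opnorm x <= 1 -> 0 < e ->
  exists n0, forall n, (n0 <= n)%N -> opnorm (iter n (damp x) x) <= e.
Proof.
move=> x1 e0; have e2 : 0 < e ^+ 2 by rewrite exprn_gt0.
(* Any [n] above [e^-2] satisfies [1 <= e^2 n]. *)
exists (Num.truncn (e ^- 2)).+1 => n hn; apply: opnorm_damp => //.
rewrite -mulr_natr mulrC -ler_pdivrMr // mul1r.
apply: le_trans (_ : (Num.truncn (e ^- 2)).+1%:R <= _); last by rewrite ler_nat.
exact/ltW/truncnS_gt.
Qed.

Lemma damp_joint_cauchy x : opnorm x <= 1 ->
  cauchy_for joint_norm (fun n => iter n (damp x) x).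
Proof.
(* The operator norm of a difference costs two quarters, one for each term, and each Hilbert norm
   costs one. *)
move=> x1 e e0; have e4 : 0 < e / 4 by lra.
have s1 : opnorm (astar x) <= 1 by rewrite opnorm_star.
have [n1 h1] := opnorm_damp_small x1 e4.
have [n2 h2] := damp_cauchy hT x1 x e4.
have [n3 h3] := damp_cauchy hT s1 (astar x) e4.
exists (maxn n1 (maxn n2 n3)) => m n; rewrite !geq_max.
move=> /andP[m1 /andP[m2 m3]] /andP[n1' /andP[n2' n3']].
rewrite joint_normE astarD astarN !astar_damp.
have := h2 _ _ m2 n2'; have := h3 _ _ m3 n3'; have := h1 _ m1; have := h1 _ n1'.
have := opnormD hT (iter m (damp x) x) (- iter n (damp x) x).
have : opnorm (- iter n (damp x) x) <= opnorm (iter n (damp x) x).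
  rewrite -scaleN1r (le_trans (opnormZ hT _ _)) //.
  by rewrite normcN1 mul1r.
by lra.
Qed.

Hypothesis complete : complete_for D joint_norm.

Lemma decomposition_contraction x : opnorm x <= 1 ->
  exists2 g, annihilator g & product_core (x - g).
Proof.
move=> x1; have [g /cvgrPdist_lt cvg_g] := complete (damp_joint_cauchy x1).
have near_g e : 0 < e -> exists n0, forall n, (n0 <= n)%N ->
    joint_norm (iter n (damp x) x - g) < e.
  move=> /cvg_g[n0 _ h]; exists n0 => n /h /=.
  by rewrite sub0r normrN => /(le_lt_trans (ler_norm _)).
exists g.
  apply/annihilatorP => z; apply: lnorm_eq0; apply/eqP; rewrite eq_le lnorm_ge0 andbT.
  (* [||g|| <= ||g - z_n|| + ||z_n||], and both terms tend to 0. *)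
  suff g0 : opnorm g <= 0.
    by apply: le_trans (lnormM hT _ _) _; rewrite mulr_le0_ge0 ?lnorm_ge0.
  apply/ler_addgt0Pr => e e0; rewrite add0r; have e2 : 0 < e / 2 by lra.
  have [n0 h0] := near_g _ e2; have [n1 h1] := opnorm_damp_small x1 e2.
  pose n := maxn n0 n1.
  have := h0 n (leq_maxl _ _); have := h1 n (leq_maxr _ _).
  set u := iter n _ _; rewrite joint_normB => hu hg.
  have := opnormD hT (g - u) u; rewrite subrK.
  have := opnorm_le_joint (g - u); lra.
(* [x - z_n] lies in the span, at joint distance [joint_norm (z_n - g)] from [x - g]. *)
move=> e /near_g[n0 h]; exists (x - iter n0 (damp x) x).
  exact: damp_sub_product_span.
by rewrite opprB addrC addrA subrK h.
Qed.

Lemma decomposition x : exists2 g, annihilator g & product_core (x - g).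
Proof.
(* Adding 1 keeps the scaling factor invertible when [x] has operator norm 0. *)
pose t := opnorm x + 1.
have t0 : 0 < t by rewrite /t; have := opnorm_ge0 hT x; lra.
have [|g Ag Eg] := @decomposition_contraction (t^-1%:C%C *: x).
  rewrite (le_trans (opnormZ hT _ _)) // normc_real ?invr_ge0 ?(ltW t0) //.
  by rewrite mulrC ler_pdivrMr // mul1r /t; lra.
exists (t%:C%C *: g); first exact: linear_subspaceZ annihilator_subspace _.
have -> : x - t%:C%C *: g = t%:C%C *: (t^-1%:C%C *: x - g).
  by rewrite scalerBr scalerA -rmorphM /= divff ?gt_eqF // scale1r.
exact: linear_subspaceZ product_core_subspace _.
Qed.

(** Subtracting annihilator parts does not change a product: [u v = (u - g) (v - h)]. So products in
    [D] are already products in the core, and joint approximation by their span is also Hilbert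
    approximation. *)
Lemma products_core_dense :
  dense_for hilbert_norm (linear_span (products product_core)) product_core.
Proof.
move=> x Ex e /Ex[y Sy xy]; exists y; last exact: le_lt_trans (hilbert_le_joint _) xy.
move: y Sy {xy}; apply: linear_spanS => _ [u _ [v _ <-]].
have [g Ag Eu] := decomposition u; have [h Ah Ev] := decomposition v.
exists (u - g) => //; exists (v - h) => //.
have /annihilatorP Ag' := Ag.
by rewrite linearBr Ah subr0 linearBl Ag' subr0.
Qed.

End JointNorm.

(** * Assembly of the orthogonal sum *)

Theorem theorem2 (R : realType) (D : star_ip_algebra R) (hD : thermal D) :
  exists b c : set (ito D),
    [/\ wiener b,
        poisson c,
        [set x + y | x in b & y in c] = [set: ito D] &
        forall x y : ito D, b x -> c y -> ito_mul x y = 0].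
Proof.
have [hT hC] := hD.
exists (ito_sub annihilator), (ito_sub product_core); split.
- exists annihilator => //; split.
  + exact: annihilator_subspace.
  + exact: annihilator_star.
  + by move=> x y _ Ay; exact: Ay.
  + exact: annihilator_closed.
- exists product_core => //; split.
  + exact: product_core_subspace.
  + apply: closure_star => //; exact: product_span_star.
  (* Any product of two elements of [D] already lies in the span. *)
  + by move=> _ [x _ [y _ <-]]; apply: sub_closure => //; exact: product_spanM.
  + exact: closure_closed.
  + exact: products_core_dense.
- apply/seteqP; split=> // a _; have [g Ag Eg] := decomposition hT hC a.2.
  (* The scalar line lies in both summands; here it goes wholly to the Wiener part. *)
  exists (a.1, g) => //; exists (0, a.2 - g) => //.
  by apply: injective_projections => /=; rewrite ?addr0 // addrC subrK.
- move=> x y Ax Ey; rewrite /ito_mul (annihilator_orthogonal hT Ax Ey).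
  by have /(annihilatorP hT) -> := Ax.
Qed.
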